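(* Let $q$ be a complex number with $|q|>1$, and let $a,b,c,d$ be parameters such that $\left| \frac{q^{a+b+1}}{q^{c+d}} \right| < 1$ (and such that no denominator below vanishes). Let \[ p(n) = q^{a+b+c+1}-q^{a+b+c+d+n} + q^{a+b+d+1} - q^{a+c+d+n+1}-q^{b+c+d+n+1}+q^{2c+2d+3n}. \] Then \[ (q^{a+b} - q^{c+d}) (q^{a+b+1} - q^{c+d})\, {}_{3}\phi_{2}\!\left[ \begin{matrix} q^{a}, q^{b}, q \\ q^{c}, q^{d} \end{matrix} \ \Big| \ q; q \right] = \sum_{n=0}^{\infty} q^{n}\, \frac{(q^{c-a};q)_n\,(q^{c-b};q)_n\,(q^{d-a};q)_n\,(q^{d-b};q)_n}{(q^{c};q)_n\,(q^{d};q)_n}\cdot \frac{p(n)}{\big( q^{1-a-b+c+d};q^2 \big)_{n} \big( q^{2-a-b+c+d};q^2 \big)_{n}}. \]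
   Context: For complex $x$ and $Q$, and integer $n\ge 0$, the $q$-shifted factorial is $(x;Q)_0=1$ and $(x;Q)_n=(1-x)(1-xQ)\cdots(1-xQ^{n-1})$ for $n\ge1$. Powers $q^{x}$ with non-integer exponent are taken as $e^{x\log q}$ for a fixed choice of $\log q$. The basic hypergeometric series is \[ {}_{3}\phi_{2}\!\left[ \begin{matrix} a_1,a_2,a_3 \\ b_1,b_2 \end{matrix} \ \Big| \ q; z \right]=\sum_{n=0}^{\infty}\frac{(a_1;q)_n(a_2;q)_n(a_3;q)_n}{(q;q)_n(b_1;q)_n(b_2;q)_n}\,z^n . \] *)

(* Defs.v *)
From Stdlib Require Export Reals.
From Coquelicot Require Export Coquelicot.

Open Scope C_scope.

Definition Cexp (z : C) : C :=
  ((exp (Re z) * cos (Im z))%R, (exp (Re z) * sin (Im z))%R).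

(* [Cpower L x] is q^x, where q = e^L and L is the chosen value of log q. *)
Definition Cpower (L x : C) : C := Cexp (x * L).

Fixpoint qpoch (x Q : C) (n : nat) : C :=
  match n with
  | O => 1
  | S m => qpoch x Q m * (1 - x * Q ^ m)
  end.

(* [C_AbsRing] and [C_NormedModule] are given explicitly because [C] also
   carries a normed module structure over [R].  [CSeries a] is the sum of the
   series when it converges, and is meaningless otherwise. *)
Definition is_Cseries (a : nat -> C) (s : C) : Prop :=
  @is_series C_AbsRing C_NormedModule a s.

Definition ex_Cseries (a : nat -> C) : Prop :=
  @ex_series C_AbsRing C_NormedModule a.

Definition CSeries (a : nat -> C) : C :=
  @iota C_CompleteNormedModule (is_Cseries a).

Definition phi32_term (a1 a2 a3 b1 b2 q z : C) (n : nat) : C :=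
  qpoch a1 q n * qpoch a2 q n * qpoch a3 q n
  / (qpoch q q n * qpoch b1 q n * qpoch b2 q n) * z ^ n.

Definition phi32 (a1 a2 a3 b1 b2 q z : C) : C :=
  CSeries (phi32_term a1 a2 a3 b1 b2 q z).

Definition p (L a b c d : C) (n : nat) : C :=
  let N := RtoC (INR n) in
  Cpower L (a + b + c + 1) - Cpower L (a + b + c + d + N)
  + Cpower L (a + b + d + 1) - Cpower L (a + c + d + N + 1)
  - Cpower L (b + c + d + N + 1) + Cpower L (2 * c + 2 * d + 3 * N).

Definition rhs_term (q L a b c d : C) (n : nat) : C :=
  q ^ n
  * (qpoch (Cpower L (c - a)) q n * qpoch (Cpower L (c - b)) q n
     * qpoch (Cpower L (d - a)) q n * qpoch (Cpower L (d - b)) q n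
     / (qpoch (Cpower L c) q n * qpoch (Cpower L d) q n))
  * (p L a b c d n
     / (qpoch (Cpower L (1 - a - b + c + d)) (q ^ 2) n
        * qpoch (Cpower L (2 - a - b + c + d)) (q ^ 2) n)).

(* Main.v *)
From Stdlib Require Import Reals Lra Lia.
Require Import Defs.

(** Write [a], [b], [c], [d] for q^a, q^b, q^c, q^d, and let S(c, d) be the sum
    of (a)_k (b)_k / ((c)_k (d)_k) q^k, which is the 3phi2 because the factors
    (q;q)_k cancel.  A Gosper-type certificate, linear in q^k, expresses
    S(c, d) - T(c, d) S(cq, dq) as a telescoping sum, so that
    S(c, d) = R(c, d) + T(c, d) S(cq, dq) with explicit rational R and T.
    Iterating (c, d) -> (cq, dq) gives the right-hand series; after N steps the
    remainder is T(c, d) ... T(cq^(N-1), dq^(N-1)) S(cq^N, dq^N).  Passing from N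
    to N + 1 multiplies the k-th term of this remainder by a bounded factor and
    divides it by (1 - c q^(N+k)) (1 - d q^(N+k)), of modulus at least
    const |q|^(2N), so the remainder tends to 0. *)

(** * Convergence of real and complex series *)

(** Comparison with a geometric series. The ratio enters as a multiplicative bound, so that terms
    may vanish, as those of a terminating 3phi2 do. *)
Lemma ratio_test (u r : nat -> R) (l : R) :
  (forall n, (0 <= u n)%R) -> (forall n, (u (S n) <= r n * u n)%R) ->
  is_lim_seq r l -> (l < 1)%R -> ex_series u.
Proof.
  intros Hu Hr Hl Hl1.
  (* The midpoint of max(l, 0) and 1 lies above l and is positive even when l is negative. *)
  set (m := ((1 + Rmax l 0) / 2)%R).
  assert (Hm : (l < m /\ 0 < m < 1)%R).
  { unfold m, Rmax; destruct (Rle_dec l 0); lra. }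
  apply is_lim_seq_spec in Hl.
  assert (He : (0 < m - l)%R) by lra.
  destruct (Hl (mkposreal _ He)) as [N HN]; simpl in HN.
  apply (ex_series_incr_n u N).
  apply (ex_series_le (V := R_CompleteNormedModule) _ (fun k => (m ^ k * u N)%R)).
  - intros k; change (norm ?x) with (Rabs x).
    rewrite Rabs_pos_eq by apply Hu.
    induction k as [|k IH].
    + rewrite Nat.add_0_r; simpl; lra.
    + rewrite Nat.add_succ_r.
      eapply Rle_trans; [apply Hr|].
      assert (H := HN (N + k)%nat ltac:(lia)).
      apply Rabs_def2 in H.
      apply Rle_trans with (m * u (N + k)%nat)%R.
      * apply Rmult_le_compat_r; [apply Hu | lra].
      * simpl; rewrite Rmult_assoc.
        apply Rmult_le_compat_l; [lra | exact IH].
  - apply ex_series_scal_r, ex_series_geom.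
    rewrite Rabs_pos_eq; lra.
Qed.

Lemma is_lim_seq_bounded (u : nat -> R) (l : R) :
  is_lim_seq u l -> exists M, (0 < M)%R /\ forall n, (u n <= M)%R.
Proof.
  intros H; apply is_lim_seq_Reals in H.
  destruct (maj_by_pos u (exist _ l H)) as [M [HM Hu]].
  exists M; split; [exact HM|]; intros n.
  eapply Rle_trans; [apply Rle_abs | apply Hu].
Qed.

Lemma is_lim_seq_squeeze_0 (u v : nat -> R) :
  (forall n, (0 <= u n <= v n)%R) -> is_lim_seq v 0 -> is_lim_seq u 0.
Proof.
  intros H Hv.
  apply is_lim_seq_le_le with (fun _ => 0%R) v; auto using is_lim_seq_const.
Qed.

Definition Csum (f : nat -> C) (n : nat) : C := @sum_n C_NormedModule f n.

(** Turns convergence in C into a real limit, where squeezing and comparison apply. *)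
Lemma is_CseriesE (f : nat -> C) (s : C) :
  is_Cseries f s <-> is_lim_seq (fun n => Cmod (Csum f n - s)) 0.
Proof.
  unfold is_Cseries, is_series; rewrite <- is_lim_seq_spec.
  rewrite (filterlim_locally_ball_norm (K := C_AbsRing) (U := C_NormedModule)).
  assert (E : forall n, Rabs (Cmod (Csum f n - s) - 0) = Cmod (Csum f n - s)).
  { intros n; rewrite Rminus_0_r; apply Rabs_pos_eq, Cmod_ge_0. }
  split; intros H eps; destruct (H eps) as [N HN]; exists N; intros n Hn;
    specialize (HN n Hn); cbv beta in *; [rewrite E | rewrite E in HN]; exact HN.
Qed.

Lemma is_Cseries_unique (f : nat -> C) (s : C) : is_Cseries f s -> CSeries f = s.
Proof.
  intros H.
  apply (iota_filterlim_locally (V := C_CompleteNormedModule) (F := eventually)).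
  exact H.
Qed.

Lemma ex_Cseries_abs (f : nat -> C) :
  ex_series (fun n => Cmod (f n)) -> ex_Cseries f.
Proof.
  intros H.
  apply (ex_series_le (K := C_AbsRing) (V := C_CompleteNormedModule) f
           (fun n => Cmod (f n))); [|exact H].
  intros n; apply Rle_refl.
Qed.

(** Pass to the limit in |s| <= |S_n - s| + |S_n|, where |S_n| is at most the n-th partial sum of
    [b]. *)
Lemma Cmod_Cseries_le (f : nat -> C) (s : C) (b : nat -> R) :
  is_Cseries f s -> (forall n, (Cmod (f n) <= b n)%R) -> ex_series b ->
  (Cmod s <= Series b)%R.
Proof.
  intros Hf Hb Eb; apply is_CseriesE in Hf.
  apply Series_correct in Eb.
  cut (Rbar_le (Cmod s) (0 + Series b)%R); [simpl; lra|].
  apply (is_lim_seq_le (fun _ => Cmod s)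
           (fun n => Cmod (Csum f n - s) + sum_n b n)%R).
  - intros n.
    apply Rle_trans with (Cmod (Csum f n - s) + Cmod (Csum f n))%R.
    + rewrite <- (Cmod_opp (Csum f n - s)).
      replace s with (- (Csum f n - s) + Csum f n) at 1 by ring.
      apply Cmod_triangle.
    + apply Rplus_le_compat_l.
      apply Rle_trans with (sum_n (fun k => Cmod (f k)) n).
      * apply (norm_sum_n_m (K := C_AbsRing) (V := C_NormedModule) f 0 n).
      * apply sum_n_m_le, Hb.
  - apply is_lim_seq_const.
  - apply (is_lim_seq_plus' _ _ 0 (Series b)); assumption.
Qed.

Lemma is_Cseries_telescope (G : nat -> C) :
  is_lim_seq (fun n => Cmod (G n)) 0 ->
  is_Cseries (fun k => G (S k) - G k) (- G O).
Proof.
  intros H; apply is_CseriesE.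
  (* [sum_n] includes the term of index n, so the partial sum is [G (S n) - G O] and the limit is
     needed along the shifted sequence. *)
  apply is_lim_seq_incr_1 in H.
  assert (E : forall n, Csum (fun k => G (S k) - G k) n = G (S n) - G O).
  { unfold Csum; induction n as [|n IH]; [now rewrite sum_O|].
    rewrite sum_Sn, IH; change (plus ?x ?y) with (Cplus x y); ring. }
  apply is_lim_seq_ext with (2 := H); intros n; rewrite E; f_equal; ring.
Qed.

(** Applied with t_n = q^(-n), this gives the limits of the rescaled factors q^(-n) - x. *)
Lemma is_lim_seq_Cmod_sub (t : nat -> C) (z : C) :
  is_lim_seq (fun n => Cmod (t n)) 0 ->
  is_lim_seq (fun n => Cmod (t n - z)) (Cmod z).
Proof.
  intros H.
  apply is_lim_seq_le_le with (fun n => Cmod z - Cmod (t n))%R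
    (fun n => Cmod z + Cmod (t n))%R.
  - intros n; split.
    + assert (H1 := Cmod_triangle (t n - z) (- t n)).
      rewrite Cmod_opp in H1.
      replace (t n - z + - t n) with (- z) in H1 by ring.
      rewrite Cmod_opp in H1; lra.
    + assert (H1 := Cmod_triangle (t n) (- z)).
      rewrite Cmod_opp in H1; unfold Cminus; lra.
  - rewrite <- (Rminus_0_r (Cmod z)) at 1.
    apply is_lim_seq_minus'; [apply is_lim_seq_const | exact H].
  - rewrite <- (Rplus_0_r (Cmod z)) at 1.
    apply is_lim_seq_plus'; [apply is_lim_seq_const | exact H].
Qed.

(** * Complex powers of q *)

Lemma Cexp_plus (z w : C) : Cexp (z + w) = Cexp z * Cexp w.
Proof.
  unfold Cexp, Cmult, Re, Im; simpl; rewrite exp_plus, cos_plus, sin_plus.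
  f_equal; ring.
Qed.

Lemma Cexp_0 : Cexp 0 = 1.
Proof. unfold Cexp, Re, Im; simpl; rewrite exp_0, cos_0, sin_0, Rmult_1_l, Rmult_0_r; reflexivity. Qed.

Lemma Cpower_plus (L x y : C) : Cpower L (x + y) = Cpower L x * Cpower L y.
Proof. unfold Cpower; rewrite <- Cexp_plus; f_equal; ring. Qed.

Lemma Cpower_neq_0 (L x : C) : Cpower L x <> 0.
Proof.
  intros H; apply C1_nz.
  rewrite <- Cexp_0; replace (RtoC 0) with ((x + - x) * L) at 1 by ring.
  change (Cpower L (x + - x) = 0); rewrite Cpower_plus, H; ring.
Qed.

Lemma Cpower_minus (L x y : C) : Cpower L (x - y) = Cpower L x / Cpower L y.
Proof.
  replace (Cpower L x) with (Cpower L (x - y) * Cpower L y)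
    by (rewrite <- Cpower_plus; f_equal; ring).
  field; apply Cpower_neq_0.
Qed.

Lemma Cpower_1 (L : C) : Cpower L 1 = Cexp L.
Proof. unfold Cpower; f_equal; ring. Qed.

Lemma Cpower_INR (L : C) (n : nat) : Cpower L (RtoC (INR n)) = Cexp L ^ n.
Proof.
  induction n as [|n IH].
  - unfold Cpower; simpl; rewrite Cmult_0_l; apply Cexp_0.
  - rewrite S_INR, RtoC_plus, Cpower_plus, IH, Cpower_1, Cpow_S; ring.
Qed.

(** * q-shifted factorials and the size of their factors for |q| > 1 *)

Lemma Cminus_neq_0 (z w : C) : (Cmod z < Cmod w)%R -> z - w <> 0.
Proof.
  intros H E; apply (Rlt_irrefl (Cmod w)).
  replace w with z at 1; [exact H|].
  rewrite <- (Cplus_0_r w), <- E; ring.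
Qed.

(** Both sides are (x; Q)_(n+1), with the last factor split off on the left and the first on the
    right. *)
Lemma qpoch_shift (x Q : C) (n : nat) :
  qpoch x Q n * (1 - x * Q ^ n) = (1 - x) * qpoch (x * Q) Q n.
Proof.
  induction n as [|n IH]; [simpl; ring|].
  cbn [qpoch]; rewrite IH, Cpow_S; ring.
Qed.

Lemma qpoch_factor_neq_0 (x Q : C) :
  (forall n, qpoch x Q n <> 0) -> forall n, 1 - x * Q ^ n <> 0.
Proof.
  intros H n E; apply (H (S n)); simpl; rewrite E; ring.
Qed.

Lemma qpoch_neq_0 (x Q : C) :
  (forall n, 1 - x * Q ^ n <> 0) -> forall n, qpoch x Q n <> 0.
Proof.
  intros H n; induction n as [|n IH]; simpl; [apply C1_nz|].
  apply Cmult_neq_0; auto.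
Qed.

Lemma base_neq_0 (q : C) : (1 < Cmod q)%R -> q <> 0.
Proof. intros H; apply Cmod_gt_0; lra. Qed.

(** Isolates the growth: q^(-n) tends to 0, so the bracket tends to -x. *)
Lemma one_minus_scale (q x : C) (n : nat) :
  (1 < Cmod q)%R -> 1 - x * q ^ n = q ^ n * (/ q ^ n - x).
Proof.
  intros H; field; apply Cpow_nz, base_neq_0, H.
Qed.

Lemma is_lim_seq_inv_Cpow (q : C) :
  (1 < Cmod q)%R -> is_lim_seq (fun n => Cmod (/ q ^ n)) 0.
Proof.
  intros H.
  apply is_lim_seq_ext with (fun n => (/ Cmod q) ^ n)%R.
  - intros n; rewrite Cmod_inv, Cmod_pow by (apply Cpow_nz, base_neq_0, H).
    apply pow_inv.
  - apply is_lim_seq_geom.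
    rewrite Rabs_pos_eq.
    + rewrite <- Rinv_1; apply Rinv_lt_contravar; lra.
    + apply Rlt_le, Rinv_0_lt_compat; lra.
Qed.

Lemma Cmod_inv_Cpow_le_1 (q : C) (n : nat) :
  (1 < Cmod q)%R -> (Cmod (/ q ^ n) <= 1)%R.
Proof.
  intros H; rewrite Cmod_inv, Cmod_pow by (apply Cpow_nz, base_neq_0, H).
  rewrite <- Rinv_1; apply Rinv_le_contravar; [lra|].
  apply pow_R1_Rle; lra.
Qed.

(** The values 1 / |q^(-n) - x| converge to 1 / |x|, hence are bounded; the factor q^n taken out of
    1 - x q^n supplies the decay. *)
Lemma inv_one_minus_bound (q x : C) :
  (1 < Cmod q)%R -> x <> 0 -> (forall n, 1 - x * q ^ n <> 0) ->
  exists K, (0 < K)%R /\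
    forall n, (Cmod (/ (1 - x * q ^ n)) <= K * Cmod (/ q ^ n))%R.
Proof.
  intros Hq Hx Hn.
  destruct (is_lim_seq_bounded (fun n => 1 / Cmod (/ q ^ n - x))%R (1 / Cmod x))
    as [K [HK HKn]].
  { apply is_lim_seq_div'.
    - apply is_lim_seq_const.
    - apply is_lim_seq_Cmod_sub, is_lim_seq_inv_Cpow, Hq.
    - apply Rgt_not_eq, Cmod_gt_0, Hx. }
  exists K; split; [exact HK|]; intros n.
  assert (Hp : q ^ n <> 0) by apply Cpow_nz, base_neq_0, Hq.
  assert (Ht : / q ^ n - x <> 0).
  { intros E; apply (Hn n); rewrite one_minus_scale, E by exact Hq; ring. }
  rewrite one_minus_scale by exact Hq.
  replace (/ (q ^ n * (/ q ^ n - x))) with (/ (/ q ^ n - x) * / q ^ n).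
  - rewrite Cmod_mult; apply Rmult_le_compat_r; [apply Cmod_ge_0|].
    rewrite Cmod_inv by exact Ht.
    specialize (HKn n); unfold Rdiv in HKn; lra.
  - specialize (Hn n); field; auto.
Qed.

(** * The telescoping certificate *)

(* The certificate is [cert_lin * x + cert_cst] with [x = q ^ k]; the two
   coefficients are found by comparing those of [x ^ 3] and [x ^ 2] in
   [certificate] below. *)
Definition cert_lin (q a b c d : C) : C := c * d / (a * b * q - c * d).

Definition cert_cst (q a b c d : C) : C :=
  ((a + b) * cert_lin q a b c d * q - (c + d) * (1 + cert_lin q a b c d))
  / (a * b - c * d).

(* T(c, d) without its factor 1 / ((1 - c) (1 - d)). *)
Definition step_factor (q a b c d : C) : C :=
  (1 - c / a) * (1 - c / b) * (1 - d / a) * (1 - d / b)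
  / ((1 - c * d / (a * b * q)) * (1 - c * d / (a * b))).

(** Both sides are cubics in x without constant term. The coefficients of x^3 and x^2 determine the
    certificate, and that of x then determines [step_factor]. *)
Lemma certificate (q a b c d x : C) :
  q <> 0 -> a <> 0 -> b <> 0 -> a * b - c * d <> 0 -> a * b * q - c * d <> 0 ->
  x * (1 - c * x) * (1 - d * x) - x * step_factor q a b c d
  = (1 - a * x) * (1 - b * x) * (cert_lin q a b c d * (q * x) + cert_cst q a b c d)
    - (1 - c * x) * (1 - d * x) * (cert_lin q a b c d * x + cert_cst q a b c d).
Proof.
  intros; unfold step_factor, cert_cst, cert_lin; field; repeat split; assumption.
Qed.

(** Minus the certificate at k = 0, that is at x = 1. Once c and d become c q^n and d q^n, the
    numerator is q^n p(n). *)
Lemma certificate_at_0 (q a b c d : C) :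
  a * b - c * d <> 0 -> a * b * q - c * d <> 0 ->
  - (cert_lin q a b c d + cert_cst q a b c d)
  = (a * b * c * q - a * b * c * d + a * b * d * q - a * c * d * q
     - b * c * d * q + c * c * d * d)
    / ((a * b - c * d) * (a * b * q - c * d)).
Proof.
  intros; unfold cert_cst, cert_lin; field; split; assumption.
Qed.

(** * The iterated remainder and its discrete primitive *)

(* The product of the step factors at (c q^i, d q^i), i < N; see [weight_S]. *)
Definition weight (q a b c d : C) (N : nat) : C :=
  qpoch (c / a) q N * qpoch (c / b) q N * qpoch (d / a) q N * qpoch (d / b) q N
  / (qpoch (c * d / (a * b * q)) (q ^ 2) N * qpoch (c * d / (a * b)) (q ^ 2) N).

Definition poch_quot (q a b c d : C) (N k : nat) : C :=
  qpoch a q k * qpoch b q k / (qpoch c q (N + k) * qpoch d q (N + k)).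

(* The k-th term of the remainder after N steps: the factors
   1 / ((1 - c) (1 - d)) left out of [step_factor] turn (c q^N)_k and (d q^N)_k
   into (c)_(N+k) and (d)_(N+k). *)
Definition remainder_term (q a b c d : C) (N k : nat) : C :=
  weight q a b c d N * poch_quot q a b c d N k * q ^ k.

(** Discrete antiderivative in k of the N-th remainder term minus the (N+1)-st: the factor q^k is
    replaced by the certificate for (c q^N, d q^N). *)
Definition primitive (q a b c d : C) (N k : nat) : C :=
  weight q a b c d N * poch_quot q a b c d N k
  * (cert_lin q a b (c * q ^ N) (d * q ^ N) * q ^ k
     + cert_cst q a b (c * q ^ N) (d * q ^ N)).

(** The hypotheses in terms of the values q^a, q^b, q^c, q^d, with the non-vanishing of (c)_n and
    (d)_n stated factor by factor. *)
Definition admissible (q a b c d : C) : Prop :=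
  (1 < Cmod q)%R /\ (a <> 0 /\ b <> 0 /\ c <> 0 /\ d <> 0)
  /\ (Cmod (a * b * q) < Cmod (c * d))%R
  /\ (forall n, 1 - c * q ^ n <> 0) /\ (forall n, 1 - d * q ^ n <> 0).

(** As |q| > 1, the convergence condition persists along (c q^n, d q^n). Hence the denominators of
    the certificate and of the step factors never vanish. *)
Lemma admissible_Cmod_lt (q a b c d : C) (n : nat) :
  admissible q a b c d ->
  (Cmod (a * b) < Cmod (c * q ^ n * (d * q ^ n)) /\
   Cmod (a * b * q) < Cmod (c * q ^ n * (d * q ^ n)))%R.
Proof.
  intros [Hq [[Ha [Hb [Hc Hd]]] [H _]]].
  assert (H1 : (Cmod (c * d) <= Cmod (c * q ^ n * (d * q ^ n)))%R).
  { replace (c * q ^ n * (d * q ^ n)) with (c * d * (q ^ n * q ^ n)) by ring.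
    rewrite (Cmod_mult (c * d)), (Cmod_mult (q ^ n)), Cmod_pow.
    assert (1 <= Cmod q ^ n)%R by (apply pow_R1_Rle; lra).
    assert (0 <= Cmod (c * d))%R by apply Cmod_ge_0.
    assert (1 <= Cmod q ^ n * Cmod q ^ n)%R by nra.
    nra. }
  assert (H2 : (Cmod (a * b) <= Cmod (a * b * q))%R).
  { rewrite (Cmod_mult _ q); assert (0 <= Cmod (a * b))%R by apply Cmod_ge_0; nra. }
  split; lra.
Qed.

Lemma admissible_diff_neq_0 (q a b c d : C) (n : nat) :
  admissible q a b c d ->
  a * b - c * q ^ n * (d * q ^ n) <> 0 /\ a * b * q - c * q ^ n * (d * q ^ n) <> 0.
Proof.
  intros H; destruct (admissible_Cmod_lt q a b c d n H).
  split; apply Cminus_neq_0; assumption.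
Qed.

Lemma Cpow_sq (q : C) (n : nat) : (q ^ 2) ^ n = q ^ n * q ^ n.
Proof. rewrite <- Cpow_mult_r, <- Cpow_add_r; f_equal; lia. Qed.

Lemma weight_denom_neq_0 (q a b c d : C) (n : nat) :
  admissible q a b c d ->
  1 - c * d / (a * b * q) * (q ^ 2) ^ n <> 0 /\ 1 - c * d / (a * b) * (q ^ 2) ^ n <> 0.
Proof.
  intros H; destruct (admissible_diff_neq_0 q a b c d n H) as [H1 H2].
  destruct H as [Hq [[Ha [Hb _]] _]]; apply base_neq_0 in Hq.
  rewrite Cpow_sq; split; intros E; [apply H2 | apply H1].
  - transitivity (a * b * q * (1 - c * d / (a * b * q) * (q ^ n * q ^ n)));
      [field; auto | rewrite E; ring].
  - transitivity (a * b * (1 - c * d / (a * b) * (q ^ n * q ^ n)));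
      [field; auto | rewrite E; ring].
Qed.

Lemma weight_S (q a b c d : C) (N : nat) :
  admissible q a b c d ->
  weight q a b c d (S N) = weight q a b c d N * step_factor q a b (c * q ^ N) (d * q ^ N).
Proof.
  intros H.
  assert (H1 : forall n, qpoch (c * d / (a * b * q)) (q ^ 2) n <> 0)
    by (apply qpoch_neq_0; intros n; apply (weight_denom_neq_0 q a b c d n H)).
  assert (H2 : forall n, qpoch (c * d / (a * b)) (q ^ 2) n <> 0)
    by (apply qpoch_neq_0; intros n; apply (weight_denom_neq_0 q a b c d n H)).
  destruct (admissible_diff_neq_0 q a b c d N H) as [H3 H4].
  specialize (H1 N); specialize (H2 N).
  destruct H as [Hq [[Ha [Hb _]] _]]; apply base_neq_0 in Hq.
  unfold weight, step_factor; cbn [qpoch]; rewrite Cpow_sq.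
  generalize dependent (qpoch (c * d / (a * b * q)) (q ^ 2) N).
  generalize dependent (qpoch (c * d / (a * b)) (q ^ 2) N).
  intros; field; repeat split; try assumption.
Qed.

Lemma poch_quot_S_l (q a b c d : C) (N k : nat) :
  admissible q a b c d ->
  poch_quot q a b c d (S N) k
  = poch_quot q a b c d N k * / (1 - c * q ^ (N + k)) * / (1 - d * q ^ (N + k)).
Proof.
  intros [_ [_ [_ [Hc Hd]]]].
  assert (Pc := qpoch_neq_0 c q Hc (N + k)).
  assert (Pd := qpoch_neq_0 d q Hd (N + k)).
  specialize (Hc (N + k)%nat); specialize (Hd (N + k)%nat).
  unfold poch_quot; rewrite Nat.add_succ_l; cbn [qpoch]; field; auto.
Qed.

Lemma poch_quot_S_r (q a b c d : C) (N k : nat) :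
  admissible q a b c d ->
  poch_quot q a b c d N (S k)
  = poch_quot q a b c d N k * ((1 - a * q ^ k) * (1 - b * q ^ k))
    * / (1 - c * q ^ (N + k)) * / (1 - d * q ^ (N + k)).
Proof.
  intros [_ [_ [_ [Hc Hd]]]].
  assert (Pc := qpoch_neq_0 c q Hc (N + k)).
  assert (Pd := qpoch_neq_0 d q Hd (N + k)).
  specialize (Hc (N + k)%nat); specialize (Hd (N + k)%nat).
  unfold poch_quot; rewrite Nat.add_succ_r; cbn [qpoch]; field; auto.
Qed.

(** This is [certificate] for (c q^N, d q^N) at x = q^k, multiplied by the common weight and
    quotient and divided by (1 - c q^(N+k)) (1 - d q^(N+k)). *)
Lemma remainder_term_telescope (q a b c d : C) (N k : nat) :
  admissible q a b c d ->
  remainder_term q a b c d N k - remainder_term q a b c d (S N) k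
  = primitive q a b c d N (S k) - primitive q a b c d N k.
Proof.
  intros H.
  unfold remainder_term, primitive.
  rewrite poch_quot_S_l, poch_quot_S_r, weight_S by exact H.
  destruct (admissible_diff_neq_0 q a b c d N H) as [H1 H2].
  destruct H as [Hq [[Ha [Hb _]] [_ [Hc Hd]]]]; apply base_neq_0 in Hq.
  assert (Id := certificate q a b (c * q ^ N) (d * q ^ N) (q ^ k) Hq Ha Hb H1 H2).
  specialize (Hc (N + k)%nat); specialize (Hd (N + k)%nat).
  rewrite Cpow_add_r in *; rewrite Cpow_S.
  generalize dependent (step_factor q a b (c * q ^ N) (d * q ^ N)).
  generalize (cert_lin q a b (c * q ^ N) (d * q ^ N)).
  generalize (cert_cst q a b (c * q ^ N) (d * q ^ N)).
  generalize (weight q a b c d N) (poch_quot q a b c d N k).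
  set (x := q ^ k) in *; set (y := q ^ N) in *; intros w r be al m Id.
  replace (1 - c * (y * x)) with (1 - c * y * x) in * by ring.
  replace (1 - d * (y * x)) with (1 - d * y * x) in * by ring.
  transitivity (w * r * (x * (1 - c * y * x) * (1 - d * y * x) - x * m)
                * / (1 - c * y * x) * / (1 - d * y * x)).
  - field; auto.
  - rewrite Id; field; auto.
Qed.

(** * Decay of the remainder *)

Lemma Cdiv_neq_0 (z w : C) : z <> 0 -> w <> 0 -> z / w <> 0.
Proof.
  intros Hz Hw E; apply Hz.
  transitivity (z / w * w); [field; exact Hw | rewrite E; ring].
Qed.

(** Consecutive terms have ratio q (1 - a q^k) (1 - b q^k) / ((1 - c q^k) (1 - d q^k)). Cancelling
    q^(2k) shows that it tends to a b q / (c d), of modulus less than 1. *)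
Lemma ex_series_remainder_term_0 (q a b c d : C) :
  admissible q a b c d ->
  ex_series (fun k => Cmod (remainder_term q a b c d 0 k)).
Proof.
  intros H; assert (H' := H).
  destruct H' as [Hq [[Ha [Hb [Hc Hd]]] [Hlt [Hc' Hd']]]].
  assert (Hq0 := base_neq_0 q Hq).
  assert (Mc : (0 < Cmod c)%R) by apply Cmod_gt_0, Hc.
  assert (Md : (0 < Cmod d)%R) by apply Cmod_gt_0, Hd.
  apply (ratio_test _
    (fun k => Cmod q * (Cmod (/ q ^ k - a) * Cmod (/ q ^ k - b))
              / (Cmod (/ q ^ k - c) * Cmod (/ q ^ k - d)))%R
    (Cmod q * (Cmod a * Cmod b) / (Cmod c * Cmod d))%R).
  - intros k; apply Cmod_ge_0.
  - intros k.
    assert (Hp : q ^ k <> 0) by apply Cpow_nz, Hq0.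
    assert (Nz : forall x, 1 - x * q ^ k <> 0 -> / q ^ k - x <> 0).
    { intros x Hx E; apply Hx; rewrite one_minus_scale, E by exact Hq; ring. }
    specialize (Hc' k); specialize (Hd' k).
    apply Nz in Hc' as Hc2; apply Nz in Hd' as Hd2.
    rewrite <- !Cmod_mult, <- Cmod_div, <- Cmod_mult by (apply Cmult_neq_0; assumption).
    apply Req_le; f_equal.
    unfold remainder_term; rewrite poch_quot_S_r, Cpow_S by exact H; cbn [Nat.add].
    rewrite !one_minus_scale in * by exact Hq.
    generalize dependent (/ q ^ k); intros; field; repeat split; try assumption.
  - apply is_lim_seq_div'; [apply is_lim_seq_mult'; [apply is_lim_seq_const|]| |];
      try apply is_lim_seq_mult'; try apply is_lim_seq_Cmod_sub, is_lim_seq_inv_Cpow, Hq.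
    apply Rgt_not_eq, Rmult_lt_0_compat; assumption.
  - rewrite !Cmod_mult in Hlt.
    apply Rlt_div_l; [apply Rmult_lt_0_compat; assumption | lra].
Qed.

(** Numerator and denominator both grow like q^(4N). After division by q^(4N) the modulus has a
    finite limit, which simplifies to |q|. *)
Lemma step_factor_bound (q a b c d : C) :
  admissible q a b c d ->
  exists M, (0 < M)%R /\
    forall N, (Cmod (step_factor q a b (c * q ^ N) (d * q ^ N)) <= M)%R.
Proof.
  intros H; assert (H' := H).
  destruct H' as [Hq [[Ha [Hb [Hc Hd]]] _]].
  assert (Hq0 := base_neq_0 q Hq).
  assert (Hq2 : (1 < Cmod (q ^ 2))%R) by (rewrite Cmod_pow; nra).
  assert (E1 : c * d / (a * b * q) <> 0).
  { apply Cdiv_neq_0; repeat apply Cmult_neq_0; assumption. }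
  assert (E2 : c * d / (a * b) <> 0).
  { apply Cdiv_neq_0; repeat apply Cmult_neq_0; assumption. }
  destruct (is_lim_seq_bounded
    (fun N => Cmod (/ q ^ N - c / a) * Cmod (/ q ^ N - c / b)
              * (Cmod (/ q ^ N - d / a) * Cmod (/ q ^ N - d / b))
              / (Cmod (/ (q ^ 2) ^ N - c * d / (a * b * q))
                 * Cmod (/ (q ^ 2) ^ N - c * d / (a * b))))%R
    (Cmod (c / a) * Cmod (c / b) * (Cmod (d / a) * Cmod (d / b))
     / (Cmod (c * d / (a * b * q)) * Cmod (c * d / (a * b))))%R) as [M [HM HMn]].
  { apply is_lim_seq_div'; [apply is_lim_seq_mult'; apply is_lim_seq_mult' | apply is_lim_seq_mult' |].
    1-4: apply is_lim_seq_Cmod_sub, is_lim_seq_inv_Cpow, Hq.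
    1-2: apply is_lim_seq_Cmod_sub, is_lim_seq_inv_Cpow, Hq2.
    apply Rgt_not_eq, Rmult_lt_0_compat; apply Cmod_gt_0; assumption. }
  exists M; split; [exact HM|]; intros N.
  destruct (weight_denom_neq_0 q a b c d N H) as [D1 D2].
  assert (Hp : q ^ N <> 0) by apply Cpow_nz, Hq0.
  eapply Rle_trans; [|apply (HMn N)].
  assert (Nz : forall x, 1 - x * (q ^ 2) ^ N <> 0 -> / (q ^ 2) ^ N - x <> 0).
  { intros x Hx E; apply Hx; rewrite one_minus_scale, E by exact Hq2; ring. }
  apply Nz in D1 as D3; apply Nz in D2 as D4.
  rewrite <- !Cmod_mult, <- Cmod_div by (apply Cmult_neq_0; assumption).
  apply Req_le; f_equal.
  destruct (admissible_diff_neq_0 q a b c d N H) as [D5 D6].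
  unfold step_factor; rewrite Cpow_sq in *.
  replace (c * q ^ N * (d * q ^ N)) with (c * d * (q ^ N * q ^ N)) in D5, D6 by ring.
  field; repeat split; assumption.
Qed.

(** The ratio is a bounded step factor times two reciprocals, each O(|q|^(-N-k)). The bound [rho] is
    uniform in k, so it carries over to sums over k. *)
Lemma remainder_term_S_le (q a b c d : C) :
  admissible q a b c d ->
  exists rho, is_lim_seq rho 0 /\
    forall N k, (Cmod (remainder_term q a b c d (S N) k)
                 <= rho N * Cmod (remainder_term q a b c d N k))%R.
Proof.
  intros H; assert (H' := H).
  destruct H' as [Hq [[Ha [Hb [Hc Hd]]] [_ [Hc' Hd']]]].
  destruct (step_factor_bound q a b c d H) as [M [HM HMn]].
  destruct (inv_one_minus_bound q c Hq Hc Hc') as [Kc [HKc HKcn]].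
  destruct (inv_one_minus_bound q d Hq Hd Hd') as [Kd [HKd HKdn]].
  exists (fun N => M * (Kc * Cmod (/ q ^ N)) * (Kd * Cmod (/ q ^ N)))%R; split.
  - replace 0%R with (M * (Kc * 0) * (Kd * 0))%R by ring.
    assert (HK : forall K, is_lim_seq (fun N => K * Cmod (/ q ^ N))%R (K * 0)%R).
    { intros K; apply is_lim_seq_mult'; [apply is_lim_seq_const|].
      apply is_lim_seq_inv_Cpow, Hq. }
    apply is_lim_seq_mult'; [apply is_lim_seq_mult'; [apply is_lim_seq_const|]|];
      apply HK.
  - intros N k.
    (* Discarding the extra decay in k makes the bound depend on N alone. *)
    assert (Hk : (Cmod (/ q ^ (N + k)) <= Cmod (/ q ^ N))%R).
    { replace (/ q ^ (N + k)) with (/ q ^ N * / q ^ k).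
      - rewrite Cmod_mult.
        assert (H1 := Cmod_inv_Cpow_le_1 q k Hq); assert (H2 := Cmod_ge_0 (/ q ^ N)); nra.
      - rewrite Cpow_add_r; field; split; apply Cpow_nz, base_neq_0, Hq. }
    assert (Bc : (Cmod (/ (1 - c * q ^ (N + k))) <= Kc * Cmod (/ q ^ N))%R).
    { eapply Rle_trans; [apply HKcn | apply Rmult_le_compat_l; lra]. }
    assert (Bd : (Cmod (/ (1 - d * q ^ (N + k))) <= Kd * Cmod (/ q ^ N))%R).
    { eapply Rle_trans; [apply HKdn | apply Rmult_le_compat_l; lra]. }
    replace (remainder_term q a b c d (S N) k) with
      (step_factor q a b (c * q ^ N) (d * q ^ N) * / (1 - c * q ^ (N + k))
       * / (1 - d * q ^ (N + k)) * remainder_term q a b c d N k)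
      by (unfold remainder_term; rewrite weight_S, poch_quot_S_l by exact H; ring).
    rewrite !Cmod_mult.
    apply Rmult_le_compat_r; [apply Cmod_ge_0|].
    repeat (apply Rmult_le_compat; try apply Rmult_le_pos; try apply Cmod_ge_0);
      auto.
Qed.

Lemma ex_series_remainder_term (q a b c d : C) (N : nat) :
  admissible q a b c d ->
  ex_series (fun k => Cmod (remainder_term q a b c d N k)).
Proof.
  intros H; destruct (remainder_term_S_le q a b c d H) as [rho [_ Hr]].
  induction N as [|N IH]; [apply ex_series_remainder_term_0, H|].
  apply (ex_series_le (V := R_CompleteNormedModule) _
    (fun k => Cmod (remainder_term q a b c d N k) * rho N)%R).
  - intros k; change (norm ?x) with (Rabs x).
    rewrite Rabs_pos_eq, Rmult_comm by apply Cmod_ge_0; apply Hr.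
  - apply ex_series_scal_r, IH.
Qed.

(** The primitive is the remainder term times a bounded bracket, and the remainder terms form an
    absolutely convergent series. *)
Lemma primitive_lim (q a b c d : C) (N : nat) :
  admissible q a b c d ->
  is_lim_seq (fun k => Cmod (primitive q a b c d N k)) 0.
Proof.
  intros H.
  set (al := cert_lin q a b (c * q ^ N) (d * q ^ N)).
  set (be := cert_cst q a b (c * q ^ N) (d * q ^ N)).
  apply is_lim_seq_squeeze_0 with
    (fun k => Cmod (remainder_term q a b c d N k) * (Cmod al + Cmod be))%R.
  - intros k; split; [apply Cmod_ge_0|].
    destruct H as [Hq _].
    assert (Hp : q ^ k <> 0) by apply Cpow_nz, base_neq_0, Hq.
    replace (primitive q a b c d N k) with
      (remainder_term q a b c d N k * (al + be * / q ^ k))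
      by (unfold primitive, remainder_term; fold al be; field; exact Hp).
    rewrite Cmod_mult; apply Rmult_le_compat_l; [apply Cmod_ge_0|].
    eapply Rle_trans; [apply Cmod_triangle|]; apply Rplus_le_compat_l.
    rewrite Cmod_mult.
    assert (H1 := Cmod_inv_Cpow_le_1 q k Hq); assert (H2 := Cmod_ge_0 be); nra.
  - rewrite <- (Rmult_0_l (Cmod al + Cmod be)).
    apply is_lim_seq_mult'; [|apply is_lim_seq_const].
    apply ex_series_lim_0, ex_series_remainder_term, H.
Qed.

(** * Summation over the iteration steps *)

(** Two telescopings: summing over k, where the primitive vanishes at infinity, expresses S_N -
    S_(N+1) by its value at k = 0; summing over N, where S_N tends to 0, leaves S_0. *)
Lemma is_Cseries_primitive (q a b c d : C) :
  admissible q a b c d ->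
  is_Cseries (fun N => - primitive q a b c d N 0)
    (CSeries (remainder_term q a b c d 0)).
Proof.
  intros H.
  set (S_ N := CSeries (remainder_term q a b c d N)).
  assert (HS : forall N, is_Cseries (remainder_term q a b c d N) (S_ N)).
  { intros N.
    destruct (ex_Cseries_abs _ (ex_series_remainder_term q a b c d N H)) as [s Hs].
    unfold S_; rewrite (is_Cseries_unique _ _ Hs); exact Hs. }
  assert (Hstep : forall N, - S_ (S N) - - S_ N = - primitive q a b c d N 0).
  { intros N.
    assert (HD := is_series_minus (K := C_AbsRing) (V := C_NormedModule) _ _ _ _ (HS N) (HS (S N))).
    assert (HT := is_Cseries_telescope _ (primitive_lim q a b c d N H)).
    apply is_Cseries_unique in HT; rewrite <- HT.
    symmetry; transitivity (S_ N - S_ (S N)); [|ring].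
    apply is_Cseries_unique.
    eapply is_series_ext; [|exact HD].
    intros k; exact (remainder_term_telescope q a b c d N k H). }
  assert (Hlim : is_lim_seq (fun N => Cmod (- S_ N)) 0).
  { destruct (remainder_term_S_le q a b c d H) as [rho [Hrho Hr]].
    set (s N := Series (fun k => Cmod (remainder_term q a b c d N k))).
    assert (Hs : forall N, (Cmod (S_ N) <= s N)%R).
    { intros N; apply Cmod_Cseries_le with (1 := HS N); [intros k; apply Rle_refl|].
      apply ex_series_remainder_term, H. }
    apply is_lim_seq_squeeze_0 with s.
    - intros N; rewrite Cmod_opp; split; [apply Cmod_ge_0 | apply Hs].
    (* The sums of moduli satisfy s_(N+1) <= rho_N s_N with rho_N tending to 0, so they are
       themselves summable and in particular tend to 0. *)
    - apply ex_series_lim_0, (ratio_test _ rho 0); [| |exact Hrho|lra].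
      + intros N; eapply Rle_trans; [apply Cmod_ge_0 | apply Hs].
      + intros N; unfold s; rewrite Rmult_comm, <- Series_scal_r.
        apply Series_le.
        * intros k; split; [apply Cmod_ge_0 | rewrite Rmult_comm; apply Hr].
        * apply ex_series_scal_r, ex_series_remainder_term, H. }
  apply is_Cseries_telescope in Hlim.
  change (is_Cseries (fun N => - primitive q a b c d N 0) (S_ O)).
  replace (S_ O) with (- - S_ O) by ring.
  eapply is_series_ext; [|exact Hlim]; exact Hstep.
Qed.

(** The numerator comes from [certificate_at_0]. The prefactor on the left and the denominators
    there turn the base points c d / (a b q) and c d / (a b) of the weight into their multiples by
    q^2. *)
Lemma primitive_0 (q a b c d : C) (n : nat) :
  admissible q a b c d ->
  (a * b - c * d) * (a * b * q - c * d) * - primitive q a b c d n 0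
  = q ^ n
    * (qpoch (c / a) q n * qpoch (c / b) q n * qpoch (d / a) q n * qpoch (d / b) q n
       / (qpoch c q n * qpoch d q n))
    * ((a * b * c * q - a * b * c * d * q ^ n + a * b * d * q
        - a * c * d * q ^ n * q - b * c * d * q ^ n * q
        + c * c * d * d * (q ^ n * q ^ n * q ^ n))
       / (qpoch (c * d / (a * b) * q) (q ^ 2) n
          * qpoch (c * d / (a * b) * q ^ 2) (q ^ 2) n)).
Proof.
  intros H.
  destruct (admissible_diff_neq_0 q a b c d n H) as [D1 D2].
  assert (D0 := admissible_diff_neq_0 q a b c d 0 H).
  change (q ^ 0) with (RtoC 1) in D0; rewrite !Cmult_1_r in D0.
  destruct D0 as [D3 D4].
  assert (V1 : qpoch (c * d / (a * b * q)) (q ^ 2) n <> 0)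
    by (apply qpoch_neq_0; intros m; apply (weight_denom_neq_0 q a b c d m H)).
  assert (V2 : qpoch (c * d / (a * b)) (q ^ 2) n <> 0)
    by (apply qpoch_neq_0; intros m; apply (weight_denom_neq_0 q a b c d m H)).
  assert (P1 := qpoch_shift (c * d / (a * b * q)) (q ^ 2) n).
  assert (P2 := qpoch_shift (c * d / (a * b)) (q ^ 2) n).
  assert (H' := H); destruct H' as [Hq [[Ha [Hb _]] [_ [Hc Hd]]]].
  apply base_neq_0 in Hq.
  assert (Pc := qpoch_neq_0 c q Hc n); assert (Pd := qpoch_neq_0 d q Hd n).
  replace (c * d / (a * b * q) * q ^ 2) with (c * d / (a * b) * q) in P1
    by (field; auto).
  transitivity ((a * b - c * d) * (a * b * q - c * d) * weight q a b c d n
    / (qpoch c q n * qpoch d q n)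
    * - (cert_lin q a b (c * q ^ n) (d * q ^ n)
         + cert_cst q a b (c * q ^ n) (d * q ^ n))).
  { unfold primitive, poch_quot; rewrite Nat.add_0_r; cbn [qpoch].
    change (q ^ 0) with (RtoC 1); field; auto. }
  rewrite certificate_at_0 by assumption.
  unfold weight.
  rewrite Cpow_sq in P1, P2.
  generalize (qpoch (c / a) q n) (qpoch (c / b) q n)
    (qpoch (d / a) q n) (qpoch (d / b) q n).
  set (U1 := qpoch (c * d / (a * b * q)) (q ^ 2) n) in *.
  set (U2 := qpoch (c * d / (a * b)) (q ^ 2) n) in *.
  set (U3 := qpoch (c * d / (a * b) * q) (q ^ 2) n) in *.
  set (U4 := qpoch (c * d / (a * b) * q ^ 2) (q ^ 2) n) in *.
  (* By [qpoch_shift], moving the base point by q^2 multiplies the factorial by its new last factor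
     over its old first one. *)
  replace U3 with (U1 * (a * b * q - c * q ^ n * (d * q ^ n)) / (a * b * q - c * d)).
  2:{ transitivity (U1 * (1 - c * d / (a * b * q) * (q ^ n * q ^ n))
        * (a * b * q / (a * b * q - c * d))); [field; auto|].
      rewrite P1; field; auto. }
  replace U4 with (U2 * (a * b - c * q ^ n * (d * q ^ n)) / (a * b - c * d)).
  2:{ transitivity (U2 * (1 - c * d / (a * b) * (q ^ n * q ^ n))
        * (a * b / (a * b - c * d))); [field; auto|].
      rewrite P2; field; auto. }
  clearbody U1 U2.
  replace (c * q ^ n * (d * q ^ n)) with (c * d * (q ^ n * q ^ n)) in * by ring.
  intros; field; repeat split; assumption.
Qed.

(** * Specialisation to powers of q *)

Theorem theorem1 (q L a b c d : C)
  (hL : Cexp L = q)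
  (hq : (1 < Cmod q)%R)
  (hconv : (Cmod (Cpower L (a + b + 1) / Cpower L (c + d)) < 1)%R)
  (hc : forall n : nat, qpoch (Cpower L c) q n <> 0)
  (hd : forall n : nat, qpoch (Cpower L d) q n <> 0)
  (h1 : forall n : nat, qpoch (Cpower L (1 - a - b + c + d)) (q ^ 2) n <> 0)
  (h2 : forall n : nat, qpoch (Cpower L (2 - a - b + c + d)) (q ^ 2) n <> 0) :
  ex_Cseries
    (phi32_term (Cpower L a) (Cpower L b) q (Cpower L c) (Cpower L d) q q)
  /\ ex_Cseries (rhs_term q L a b c d)
  /\ (Cpower L (a + b) - Cpower L (c + d))
     * (Cpower L (a + b + 1) - Cpower L (c + d))
     * phi32 (Cpower L a) (Cpower L b) q (Cpower L c) (Cpower L d) q q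
     = CSeries (rhs_term q L a b c d).
Proof.
  assert (H1 : Cpower L 1 = q) by (rewrite Cpower_1; exact hL).
  assert (HN : forall n : nat, Cpower L (RtoC (INR n)) = q ^ n)
    by (intros n; rewrite Cpower_INR, hL; reflexivity).
  assert (Ea := Cpower_neq_0 L a); assert (Eb := Cpower_neq_0 L b).
  assert (Ec := Cpower_neq_0 L c); assert (Ed := Cpower_neq_0 L d).
  assert (Eq := base_neq_0 q hq).
  assert (Adm : admissible q (Cpower L a) (Cpower L b) (Cpower L c) (Cpower L d)).
  { split; [exact hq|]; split; [auto|]; split;
      [|split; apply qpoch_factor_neq_0; assumption].
    rewrite !Cpower_plus, H1, Cmod_div in hconv by (apply Cmult_neq_0; assumption).
    apply Rlt_div_l in hconv; [lra | apply Cmod_gt_0, Cmult_neq_0; assumption]. }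
  (* For N = 0 the weight is 1, and the third upper parameter q cancels (q; q)_k, whose factors 1 -
     q^(n+1) are non-zero because |q| > 1. *)
  assert (Ephi : forall k,
    remainder_term q (Cpower L a) (Cpower L b) (Cpower L c) (Cpower L d) 0 k
    = phi32_term (Cpower L a) (Cpower L b) q (Cpower L c) (Cpower L d) q q k).
  { intros k; unfold remainder_term, weight, poch_quot, phi32_term.
    cbn [qpoch Nat.add].
    specialize (hc k); specialize (hd k).
    assert (Hqk : qpoch q q k <> 0).
    { apply qpoch_neq_0; intros n E.
      apply (Cminus_neq_0 1 (q ^ S n)); [|rewrite Cpow_S; exact E].
      rewrite Cmod_1, Cmod_pow; apply Rlt_pow_R1; [exact hq | lia]. }
    field; auto. }
  assert (Hphi : ex_Cseries
    (phi32_term (Cpower L a) (Cpower L b) q (Cpower L c) (Cpower L d) q q)).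
  { apply ex_Cseries_abs.
    apply (ex_series_ext (fun k => Cmod (remainder_term q (Cpower L a) (Cpower L b)
                                           (Cpower L c) (Cpower L d) 0 k))).
    - intros k; rewrite Ephi; reflexivity.
    - apply ex_series_remainder_term, Adm. }
  assert (Hrhs : is_Cseries (rhs_term q L a b c d)
    ((Cpower L (a + b) - Cpower L (c + d))
     * (Cpower L (a + b + 1) - Cpower L (c + d))
     * phi32 (Cpower L a) (Cpower L b) q (Cpower L c) (Cpower L d) q q)).
  { assert (HS := is_Cseries_primitive _ _ _ _ _ Adm).
    replace (CSeries _) with
      (phi32 (Cpower L a) (Cpower L b) q (Cpower L c) (Cpower L d) q q) in HS.
    2:{ destruct Hphi as [s Hs].
        unfold phi32; rewrite (is_Cseries_unique _ _ Hs).
        symmetry; apply is_Cseries_unique.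
        eapply is_series_ext; [|exact Hs]; intros k; symmetry; apply Ephi. }
    apply (is_series_scal (K := C_AbsRing) (V := C_NormedModule)
      ((Cpower L (a + b) - Cpower L (c + d))
       * (Cpower L (a + b + 1) - Cpower L (c + d)))) in HS.
    eapply is_series_ext; [|exact HS].
    intros n; change (scal ?x ?y) with (Cmult x y); cbv beta.
    rewrite !Cpower_plus, H1.
    rewrite (primitive_0 _ _ _ _ _ n Adm).
    unfold rhs_term, p.
    (* The exponents are regrouped so that the power laws produce exactly the monomials of
       [primitive_0]. *)
    replace (2 * c + 2 * d + 3 * RtoC (INR n)) with
      (c + c + d + d + (RtoC (INR n) + RtoC (INR n) + RtoC (INR n))) by ring.
    replace (1 - a - b + c + d) with (c + d - (a + b) + 1) by ring.
    replace (2 - a - b + c + d) with (c + d - (a + b) + (1 + 1)) by ring.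
    repeat rewrite ?Cpower_plus, ?Cpower_minus, ?HN, ?H1.
    replace (q * q) with (q ^ 2) by (simpl; ring).
    reflexivity. }
  split; [exact Hphi|]; split.
  - eexists; exact Hrhs.
  - symmetry; apply is_Cseries_unique, Hrhs.
Qed.
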